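(* Let $X$ be a topological space. The following are equivalent: (1) $X$ satisfies $\mathsf{U}_{\mathrm{fin}}(\mathcal{O},\Omega)$. (2) $X$ satisfies $\mathsf{S}_{\mathrm{fin}}(\mathcal{O},\mathcal{O})$, and $\Lambda=\gimel(\Omega)$. (3) ONE has no winning strategy in the game $\mathsf{G}_{\mathrm{fin}}(\Omega,\gimel(\Omega))$. (4) $X$ satisfies $\mathsf{S}_{\mathrm{fin}}(\Omega,\gimel(\Omega))$. (5) For each positive integer $k$, $\Omega\to\lceil\gimel(\Omega)\rceil^2_k$ holds. (6) $\Omega\to\lceil\gimel(\Omega)\rceil^2_2$ holds.
   Context: Convention: a cover of the topological space $X$ is always a countable collection $\mathcal{U}$ of open subsets of $X$ such that $\bigcup\mathcal{U}=X$ and $X\notin\mathcal{U}$. $\mathscr{A},\mathscr{B}$ denote families of such covers of the underlying space $X$. $\mathcal{O}$ is the family of all covers of $X$. $\mathcal{U}$ is a large cover if each $x\in X$ belongs to infinitely many $U\in\mathcal{U}$; $\Lambda$ is the family of all large covers of $X$. $\mathcal{U}$ is an $\omega$-cover if $X\notin\mathcal{U}$ and for each finite $F\subseteq X$ there is $U\in\mathcal{U}$ with $F\subseteq U$; $\Omega$ is the family of all $\omega$-covers of $X$. A cover $\mathcal{U}$ of $X$ is multifinite if there is a partition of $\mathcal{U}$ into infinitely many finite covers of $X$. $\gimel(\mathscr{A})$ is the family of all covers $\mathcal{U}$ of $X$ such that either $\mathcal{U}$ is multifinite, or there is a partition $\mathcal{P}$ of $\mathcal{U}$ into finite sets such that $\{\bigcup\mathcal{F}:\mathcal{F}\in\mathcal{P}\}\setminus\{X\}\in\mathscr{A}$.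 $\mathsf{S}_{\mathrm{fin}}(\mathscr{A},\mathscr{B})$: for each sequence $\{\mathcal{U}_n\}_{n\in\mathbb{N}}$ of members of $\mathscr{A}$ there are finite subsets $\mathcal{F}_n\subseteq\mathcal{U}_n$, $n\in\mathbb{N}$, such that $\bigcup_n\mathcal{F}_n\in\mathscr{B}$. $\mathsf{U}_{\mathrm{fin}}(\mathscr{A},\mathscr{B})$: for each sequence $\{\mathcal{U}_n\}_{n\in\mathbb{N}}$ of elements of $\mathscr{A}$ which do not contain a finite subcover, there are finite (possibly empty) subsets $\mathcal{F}_n\subseteq\mathcal{U}_n$, $n\in\mathbb{N}$, such that $\{\bigcup\mathcal{F}_n:n\in\mathbb{N}\}\in\mathscr{B}$. $\mathsf{G}_{\mathrm{fin}}(\mathscr{A},\mathscr{B})$ is the game of two players, ONE and TWO, with an inning for each natural number $n$: in the $n$th inning ONE chooses $\mathcal{U}_n\in\mathscr{A}$ and TWO answers with a finite subset $\mathcal{F}_n\subseteq\mathcal{U}_n$. TWO wins if $\bigcup_n\mathcal{F}_n\in\mathscr{B}$; otherwise ONE wins. $[A]^n$ denotes the set of $n$-element subsets of $A$. For a positive integer $k$, the Baumgartner-Taylor partition relation $\mathscr{A}\to\lceil\mathscr{B}\rceil^2_k$ is the statement: for each $A\in\mathscr{A}$ and each $f:[A]^2\to\{1,\dots,k\}$ there are $B\subseteq A$ with $B\in\mathscr{B}$, a partition of $B$ into finite pieces $B=\bigcup_{n\in\mathbb{N}}B_n$, and $j\in\{1,\dots,k\}$, such that $f(\{U,V\})=j$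 for all $U,V\in B$ which do not belong to the same $B_n$. *)

(* Defs.v *)
From HB Require Import structures.
From mathcomp Require Import all_boot.
From mathcomp Require Import mathcomp_extra boolp classical_sets functions.
From mathcomp Require Import cardinality topology.

Set Implicit Arguments.
Unset Strict Implicit.
Unset Printing Implicit Defensive.

Local Open Scope classical_set_scope.

Definition is_cover (X : topologicalType) (U : set (set X)) : Prop :=
  [/\ countable U, U `<=` open, \bigcup_(A in U) A = [set: X] & ~ U [set: X]].

Definition covers (X : topologicalType) : set (set (set X)) :=
  [set U | is_cover U].

Definition large_covers (X : topologicalType) : set (set (set X)) :=
  [set U | is_cover U /\ forall x : X, infinite_set [set A | U A /\ A x]].

Definition omega_covers (X : topologicalType) : set (set (set X)) :=
  [set U | is_cover U /\
    forall F : set X, finite_set F -> exists2 A, U A & F `<=` A].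

Arguments covers X : clear implicits.
Arguments large_covers X : clear implicits.
Arguments omega_covers X : clear implicits.

(* Covers are countable, so a partition into infinitely many pieces can be
   indexed by nat.  When X is nonempty every finite cover is nonempty, hence the
   pieces P n are automatically nonempty and pairwise distinct.  When X is empty
   its only cover, the empty family, counts as multifinite: it is a large cover,
   but omega_covers X is empty, so it could not enter gimel (omega_covers X) in
   any other way. *)
Definition multifinite (X : topologicalType) (U : set (set X)) : Prop :=
  exists P : nat -> set (set X),
    [/\ \bigcup_n P n = U, trivIset setT P
      & forall n, finite_set (P n) /\ is_cover (P n)].

Definition gimel (X : topologicalType) (AA : set (set (set X))) :
    set (set (set X)) :=
  [set U | is_cover U /\
    (multifinite U \/
     exists P : set (set (set X)),
       [/\ partition P id U, forall F, P F -> finite_set F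
         & AA ([set \bigcup_(A in F) A | F in P] `\ [set: X])])].

Definition S_fin (X : topologicalType) (AA BB : set (set (set X))) : Prop :=
  forall U : nat -> set (set X), (forall n, AA (U n)) ->
  exists F : nat -> set (set X),
    (forall n, finite_set (F n) /\ F n `<=` U n) /\ BB (\bigcup_n F n).

Definition has_finite_subcover (X : topologicalType) (U : set (set X)) : Prop :=
  exists F : set (set X), [/\ F `<=` U, finite_set F & is_cover F].

Definition U_fin (X : topologicalType) (AA BB : set (set (set X))) : Prop :=
  forall U : nat -> set (set X),
    (forall n, AA (U n) /\ ~ has_finite_subcover (U n)) ->
  exists F : nat -> set (set X),
    (forall n, finite_set (F n) /\ F n `<=` U n) /\
    BB (range (fun n => \bigcup_(A in F n) A)).

(* A strategy of ONE gives her move as a function of the finite sequence of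
   TWO's previous moves.  Asking for a member of AA also after sequences that
   cannot occur in a play is harmless: her first move is already in AA, and
   any such value can be replaced by it. *)
Definition G_fin_strategy_ONE (X : topologicalType) (AA : set (set (set X)))
    (sigma : seq (set (set X)) -> set (set X)) : Prop :=
  forall s, AA (sigma s).

Definition G_fin_play_against (X : topologicalType)
    (sigma : seq (set (set X)) -> set (set X)) (F : nat -> set (set X)) : Prop :=
  forall n, finite_set (F n) /\ F n `<=` sigma (mkseq F n).

Definition G_fin_ONE_has_winning_strategy (X : topologicalType)
    (AA BB : set (set (set X))) : Prop :=
  exists sigma : seq (set (set X)) -> set (set X),
    G_fin_strategy_ONE AA sigma /\
    forall F, G_fin_play_against sigma F -> ~ BB (\bigcup_n F n).

Definition nsubsets (T : Type) (A : set T) (n : nat) : set (set T) :=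
  [set D | D `<=` A /\ (D #= `I_n)%card].

(* The pieces C n may be empty, so that a family of pieces indexed by nat also
   describes partitions into finitely many pieces.  For infinite B (such as every
   member of gimel (omega_covers X) when X is nonempty) the empty ones can be
   dropped and the others renumbered. *)
Definition baumgartner_taylor (X : topologicalType) (AA BB : set (set (set X)))
    (k : nat) : Prop :=
  forall A : set (set X), AA A ->
  forall f : set (set X) -> nat,
    (forall D, nsubsets A 2 D -> (1 <= f D <= k)%N) ->
  exists (B : set (set X)) (C : nat -> set (set X)) (j : nat),
    [/\ B `<=` A /\ BB B,
        \bigcup_n C n = B /\ trivIset setT C,
        forall n, finite_set (C n),
        (1 <= j <= k)%N
      & forall U V, B U -> B V -> ~ (exists n, C n U /\ C n V) ->
          f [set U; V] = j].

(* Main.v *)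
Require Import Defs.
From mathcomp Require Import all_boot.
From mathcomp Require Import mathcomp_extra boolp classical_sets functions.
From mathcomp Require Import cardinality topology.

(** Everything is routed through one diagonalization principle for exhaustions,
    that is, increasing sequences of open sets covering [X]. A sequence of
    exhaustions [V n] can be cut off at heights [f n] so that every set of a
    given class is contained in some [V n (f n)]
    ([exhaustion_selection]). For singletons this is the Menger property
    S_fin(O, O); for finite sets it is U_fin(O, Omega), because the unions of
    finite subfamilies of a countable cover form an exhaustion.

    From (1) to (2) ([large_gimel_omega]): enumerate a large cover as [u 0],
    [u 1], ... If each tail has a finite subcover, then consecutive intervals
    of the enumeration form a multifinite partition. Otherwise the unions of
    the [u i] with [n <= i < m] are, for each [n], an exhaustion; the principle
    gives a function [h] such that each finite set is covered by the interval
    from [n] to [h n] for infinitely many [n], and these intervals can be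
    rearranged into consecutive ones ([consecutive_intervals]).

    From (2) to (3): Hurewicz's theorem that in a Menger space ONE does not win
    the Menger game, in the form where TWO produces a large cover
    ([Menger_ONE_no_winning_strategy]). The infinitely many positions of
    inning [n] are merged into a single exhaustion: when positions of a play
    are assigned increasing sets, an answer of height at least [m] already
    secures what height [m] would secure later, so that only the finitely many
    positions with all answers below [m] matter ([tree_exhaustion]).

    (3) gives (4), a sequence of covers being a strategy that ignores TWO.

    From (3) to (5) ([game_baumgartner_taylor]): an ultrafilter containing all
    sets of members of the given omega-cover that include a prescribed finite
    set consists of omega-covers. It assigns to each member of the cover the
    colour it has with almost all others, and it selects one colour [j]
    assigned almost everywhere. ONE offers only members that have colour [j]
    with all those already chosen, and the moves of TWO are the pieces.

    Finally (4) and (6) each give back the principle, hence (1), (2) and (3).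
    In both cases a member of gimel(Omega) is found whose elements lie below a
    sequence of exhaustions, finitely many in each row; its disjoint finite
    pieces can be bounded row by row ([blocks_exhaustion_selection]). *)

Set Implicit Arguments.
Unset Strict Implicit.
Unset Printing Implicit Defensive.

Local Open Scope classical_set_scope.

(** * Finite and countable sets *)

Lemma finite_uniform_bound (T : Type) (A : set T) (R : T -> nat -> Prop) :
  finite_set A ->
  (forall a m m', (m <= m')%N -> R a m -> R a m') ->
  (forall a, A a -> exists m, R a m) ->
  exists m, forall a, A a -> R a m.
Proof.
move=> /(@finite_seqP {classic T})[s ->] Rmono.
elim: s => [|b s IHs] Rex; first by exists 0%N.
have [m1 Rm1] : exists m, forall a, [set` s] a -> R a m.
  by apply: IHs => a /= sa; apply: Rex; rewrite /= inE sa orbT.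
have [m2 Rm2] : exists m, R b m by apply: Rex; rewrite /= inE eqxx.
exists (maxn m1 m2) => a /=; rewrite inE => /orP[/eqP ->|sa].
  by apply: Rmono Rm2; rewrite leq_maxr.
by apply: Rmono (Rm1 a sa); rewrite leq_maxl.
Qed.

Lemma countable_range (T : Type) (u : nat -> T) : countable (range u).
Proof. exact: sub_countable (card_image_le u setT) (countableP _). Qed.

Lemma countable_filtration (T : Type) (A : set T) : countable A ->
  exists E : nat -> set T, [/\ forall m, finite_set (E m),
    forall m m', (m <= m')%N -> E m `<=` E m' & \bigcup_m E m = A].
Proof.
move=> /countable_injP[c c_inj].
exists (fun m => A `&` [set a | (c a < m)%N]); split.
- move=> m; set D := A `&` _.
  have D_inj : {in D &, injective c}.
    move=> a b; rewrite !inE => -[Aa _] [Ab _].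
    by apply: c_inj; rewrite inE.
  rewrite -(eq_finite_set (inj_card_eq D_inj)).
  by apply: sub_finite_set (finite_II m) => _ [a [_ am] <-].
- by move=> m m' mm' a [Aa am]; split=> //=; apply: leq_trans mm'.
- apply/seteqP; split=> [a [m _ []]//|a Aa].
  by exists (c a).+1 => //; split => /=.
Qed.

Lemma card_pair (T : Type) (a b : T) : a <> b -> ([set a; b] #= `I_2)%card.
Proof.
move=> ab; pose g (i : nat) := if i is 0%N then a else b.
have g_inj : {in `I_2 &, injective g}.
  by move=> [|[|i]] [|[|j]]; rewrite !inE => //= _ _ // /esym.
rewrite (_ : [set a; b] = g @` `I_2); first exact: inj_card_eq g_inj.
apply/seteqP; split=> [x [->|->]|x [[|i] _ <-]]; [| |by left|by right].
  by exists 0%N.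
by exists 1%N.
Qed.

(** * Consecutive intervals of natural numbers *)

Definition interval (a b : nat) : set nat := [set i | (a <= i < b)%N].

Lemma interval_finite a b : finite_set (interval a b).
Proof. by apply: sub_finite_set (finite_II b) => i /andP[]. Qed.

Lemma intervals_partition (T : Type) (u : nat -> T) (l : nat -> nat) :
  injective u -> l 0%N = 0%N -> (forall j, (l j < l j.+1)%N) ->
  \bigcup_j u @` interval (l j) (l j.+1) = range u /\
  trivIset setT (fun j => u @` interval (l j) (l j.+1)).
Proof.
move=> u_inj l0 l_incr.
have l_homo : {homo l : i j / (i <= j)%N}.
  exact: homo_leq leqnn leq_trans (fun i => ltnW (l_incr i)).
split.
- apply/seteqP; split=> [_ [j _ [i _ <-]]|_ [i _ <-]]; first by exists i.
  suff [j ij] : exists j, (l j <= i < l j.+1)%N by exists j => //; exists i.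
  elim: i => [|i [j /andP[lji ilj]]].
    by exists 0%N; rewrite l0 leqnn /= -{1}l0.
  have [ij|] := ltnP i.+1 (l j.+1); first by exists j; rewrite ij leqW.
  move=> lji'; exists j.+1; rewrite lji' /=.
  by apply: leq_ltn_trans (l_incr j.+1).
- move=> j j' _ _ [_ [[i /andP[lji ilj] <-] [i' /andP[lj'i ilj'] /u_inj ii']]].
  move: lj'i ilj'; rewrite ii' => lj'i ilj'; apply/eqP.
  rewrite eqn_leq; apply/andP; split; rewrite leqNgt; apply/negP => /l_homo ll.
    by have := leq_trans (leq_trans ilj' ll) lji; rewrite ltnn.
  by have := leq_trans (leq_trans ilj ll) lj'i; rewrite ltnn.
Qed.

(** If each finite set is captured by intervals from [n] to [h n], then a
    sequence [k] growing faster than [h] captures it by two adjacent intervals,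
    from [k i] to [k i.+2]. Adjacent intervals can be paired starting at an
    even or at an odd index; were both pairings to fail, the union of the two
    counterexamples would not be captured at all. *)
Lemma consecutive_intervals (T : Type) (W : nat -> nat -> set T)
    (h : nat -> nat) :
  (forall a a' b b', (a <= a')%N -> (b' <= b)%N -> W a' b' `<=` W a b) ->
  (forall G, finite_set G -> forall N, exists2 n,
    (N <= n)%N & G `<=` W n (h n)) ->
  exists l : nat -> nat, [/\ l 0%N = 0%N, forall j, (l j < l j.+1)%N
    & forall G, finite_set G -> forall N, exists2 j,
        (N <= j)%N & G `<=` W (l j) (l j.+1)].
Proof.
move=> Wmono hP.
pose k := nat_rec (fun=> nat) 0%N (fun _ ki => (ki + \max_(n < ki) h n).+1).
have k_incr i : (k i < k i.+1)%N by rewrite /= ltnS leq_addr.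
have k_homo : {homo k : i j / (i <= j)%N}.
  exact: homo_leq leqnn leq_trans (fun i => ltnW (k_incr i)).
have kh n i : (n < k i)%N -> (h n <= k i.+1)%N.
  move=> ni /=; apply/leqW/(leq_trans _ (leq_addl _ _)).
  exact: leq_bigmax (Ordinal ni).
have k0 : k 0%N = 0%N by [].
clearbody k.
have kP n : exists i, (k i <= n < k i.+1)%N.
  have [kU _] := intervals_partition (@inj_id nat) k0 k_incr.
  have : range (@id nat) n by exists n.
  by rewrite -kU => -[i _ [n' n'i <-]]; exists i.
have hk G N : finite_set G -> exists2 i, (N <= i)%N & G `<=` W (k i) (k i.+2).
  move=> /hP/(_ (k N))[n Nn Gn]; have [i /andP[ki_n n_ki]] := kP n.
  exists i; last by apply: subset_trans Gn _; apply: Wmono => //; apply: kh.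
  rewrite leqNgt; apply/negP => /k_homo /(leq_trans n_ki)/leq_trans/(_ Nn).
  by rewrite ltnn.
have [l1P|] := pselect (forall G, finite_set G -> forall N, exists2 j,
    (N <= j)%N & G `<=` W (k j.*2) (k j.+1.*2)).
  exists (fun j => k j.*2); split=> // j /=.
  by rewrite doubleS; exact: ltn_trans (k_incr _) (k_incr _).
move=> /existsNP[G1 /not_implyP[G1fin /existsNP[N1 G1P]]].
(* Truncated predecessor makes the first point [k 0] for [j = 0]. *)
exists (fun j => k j.*2.-1); split=> // [[|j]|G Gfin N].
- exact: k_incr.
- by rewrite !doubleS /=; exact: ltn_trans (k_incr _) (k_incr _).
have [|i Ni GG1] := hk (G1 `|` G) (N1 + N).*2.+1; first by rewrite finite_setU.
have Ni2 : (N1 + N <= i./2)%N.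
  by rewrite -[X in (X <= _)%N](half_bit_double _ true) add1n half_leq.
have := odd_double_half i.
case: (odd i); rewrite ?add0n ?add1n => iE; last first.
  case: G1P; exists i./2; first by apply: leq_trans Ni2; exact: leq_addr.
  by rewrite doubleS iE => x G1x; apply: GG1; left.
exists i./2.+1; first by apply/leqW/(leq_trans _ Ni2); exact: leq_addl.
by rewrite !doubleS /= iE => x Gx; apply: GG1; right.
Qed.

(** * Exhaustions by open sets *)

Section Covers.
Variable X : topologicalType.
Implicit Types (U F : set (set X)) (G A : set X).

Lemma omega_covers_intro U : countable U -> U `<=` open -> ~ U [set: X] ->
  (forall G, finite_set G -> exists2 A, U A & G `<=` A) -> omega_covers X U.
Proof.
move=> Ucount Uopen UT Uom; split=> //; split=> //.
apply/seteqP; split=> // x _.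
by have [A UA xA] := Uom _ (finite_set1 x); exists A => //; apply: xA.
Qed.

Definition exhaustion (V : nat -> set X) : Prop :=
  [/\ forall m, open (V m), forall m, V m `<=` V m.+1
    & forall x, exists m, V m x].

(** For the class of singletons this expresses the Menger property, for the
    class of finite sets the property U_fin(O, Omega). Exhaustions take the
    place of covers since no case distinction on finite subcovers is needed
    and since intersections of finitely many of them are again exhaustions. *)
Definition exhaustion_selection (GG : set (set X)) : Prop :=
  forall V : nat -> nat -> set X, (forall n, exhaustion (V n)) ->
  exists f : nat -> nat, forall G, GG G -> exists n, G `<=` V n (f n).

Lemma exhaustion_le V m m' : exhaustion V -> (m <= m')%N -> V m `<=` V m'.
Proof.
case=> _ V_incr _.
exact: (homo_leq (fun A => @subset_refl _ A)
  (fun B A C => @subset_trans _ B A C)).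
Qed.

Lemma exhaustion_finite V G : exhaustion V -> finite_set G ->
  exists m, G `<=` V m.
Proof.
move=> Vex Gfin; have [_ _ Vcov] := Vex.
apply: (finite_uniform_bound (R := fun x m => V m x) Gfin) => //.
by move=> x m m' mm'; apply: exhaustion_le.
Qed.

Lemma exhaustion_finite_subfamily V F : exhaustion V -> finite_set F ->
  F `<=` range V -> exists m, forall A, F A -> A `<=` V m.
Proof.
move=> Vex Ffin FV.
apply: (finite_uniform_bound (R := fun A m => A `<=` V m) Ffin) => //.
- by move=> A m m' mm' Am; apply: subset_trans Am _; apply: exhaustion_le.
- by move=> A /FV[m _ <-]; exists m.
Qed.

Lemma exhaustion_omega_cover V : exhaustion V -> (forall m, V m <> setT) ->
  omega_covers X (range V).
Proof.
move=> Vex Vneq; have [Vopen _ _] := Vex; apply: omega_covers_intro.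
- exact: countable_range.
- by move=> _ [m _ <-].
- by move=> [m _]; apply: Vneq.
- by move=> G /(exhaustion_finite Vex)[m Gm]; exists (V m).
Qed.

(** Apply the selection to each tail of each of countably many sequences; since
    only finitely many of the resulting functions are defined at [n], a single
    [f] dominates them all. For a constant family in [c] this improves some [n]
    to infinitely many [n]. *)
Lemma exhaustion_selection_uniform GG : exhaustion_selection GG ->
  forall V : nat -> nat -> nat -> set X, (forall c n, exhaustion (V c n)) ->
  exists f : nat -> nat, forall G, GG G -> forall c, exists2 n,
    (c <= n)%N & G `<=` V c n (f n).
Proof.
move=> sel V Vex.
have [g gP] := choice (fun c => sel (fun n => V c (c + n)%N)
  (fun n => Vex c (c + n)%N)).
exists (fun n => \max_(c < n.+1) g c (n - c)%N) => G GGG c.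
have [n Gn] := gP c G GGG; exists (c + n)%N; first exact: leq_addr.
apply: subset_trans Gn (exhaustion_le (Vex _ _) _).
have cn : (c < (c + n).+1)%N by rewrite ltnS leq_addr.
have := leq_bigmax (F := fun c' : 'I_(c + n).+1 => g c' (c + n - c')%N)
  (Ordinal cn).
by rewrite /= addKn.
Qed.

(** Row [n] may be replaced by the intersection of the rows up to [n], and a
    row containing the whole space makes the selection trivial. *)
Lemma exhaustion_selection_reduction GG :
  (forall V : nat -> nat -> set X, (forall n, exhaustion (V n)) ->
    (forall n m, V n m <> setT) -> (forall n m, V n.+1 m `<=` V n m) ->
    exists f : nat -> nat, forall G, GG G -> exists n, G `<=` V n (f n)) ->
  exhaustion_selection GG.
Proof.
move=> sel V Vex.
have [[[n m] /= VT]|VneqT] := pselect (exists p, V p.1 p.2 = setT).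
  by exists (fun=> m) => G _; exists n; rewrite VT.
pose W n m := [set x | forall i, (i <= n)%N -> V i m x].
have WV n m : W n m `<=` V n m by move=> x /(_ n); apply.
have [|||f fP] := sel W.
- move=> n; split=> [m|m x Wx i /Wx|x].
  + elim: n => [|n IHn].
      rewrite (_ : W 0%N m = V 0%N m); first by case: (Vex 0%N).
      by apply/seteqP; split=> // x Vx i; rewrite leqn0 => /eqP ->.
    rewrite (_ : W n.+1 m = W n m `&` V n.+1 m).
      by apply: openI => //; case: (Vex n.+1).
    apply/seteqP; split=> [x Wx|x [Wx Vx] i].
      by split=> [i /leqW|]; apply: Wx.
    by rewrite leq_eqVlt => /orP[/eqP ->|/Wx].
  + by apply: exhaustion_le.
  + have [m Vm] : exists m, forall i, `I_n.+1 i -> V i m x.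
      apply: (finite_uniform_bound (R := fun i m => V i m x)).
      * exact: finite_II.
      * by move=> i m m' mm'; apply: exhaustion_le.
      * by move=> i _; case: (Vex i).
    by exists m => i; apply: Vm.
- move=> n m WT; apply: VneqT; exists (n, m) => /=.
  by rewrite -subTset -WT.
- by move=> n m x Wx i /leqW; apply: Wx.
- by exists f => G /fP[n Gn]; exists n; apply: subset_trans Gn _.
Qed.

Lemma S_fin_exhaustion_selection : S_fin (covers X) (covers X) ->
  exhaustion_selection (range (@set1 X)).
Proof.
move=> menger; apply: exhaustion_selection_reduction => V Vex Vneq _.
have [|F [Ffin [_ _ Fcov _]]] := menger (fun n => range (V n)).
  by move=> n; case: (exhaustion_omega_cover (Vex n) (Vneq n)).
have [f fP] := choice (fun n =>
  exhaustion_finite_subfamily (Vex n) (proj1 (Ffin n)) (proj2 (Ffin n))).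
exists f => _ [x _ <-]; have : setT x by [].
rewrite -Fcov => -[A [n _ FnA] Ax]; exists n => _ ->.
exact: fP Ax.
Qed.

Lemma U_fin_exhaustion_selection : U_fin (covers X) (omega_covers X) ->
  exhaustion_selection (@finite_set X).
Proof.
move=> ufin; apply: exhaustion_selection_reduction => V Vex Vneq _.
have [n|F [Ffin [_ Fom]]] := ufin (fun n => range (V n)).
  split=> [|[F [FV Ffin [_ _ Fcov _]]]].
    by case: (exhaustion_omega_cover (Vex n) (Vneq n)).
  have [m Fm] := exhaustion_finite_subfamily (Vex n) Ffin FV.
  apply: (Vneq n m); rewrite -subTset -Fcov => x [A FA Ax].
  exact: Fm Ax.
have [f fP] := choice (fun n =>
  exhaustion_finite_subfamily (Vex n) (proj1 (Ffin n)) (proj2 (Ffin n))).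
exists f => G /Fom[_ [n _ <-] Gn]; exists n => x /Gn[A FA Ax].
exact: fP Ax.
Qed.

Lemma countable_open_exhaustion U : is_cover U ->
  exists E : nat -> set (set X), [/\ forall m, finite_set (E m),
    forall m, E m `<=` U & exhaustion (fun m => \bigcup_(A in E m) A)].
Proof.
move=> [Ucount Uopen Ucov _].
have [E [Efin Eincr EU]] := countable_filtration Ucount.
have EsubU m : E m `<=` U by rewrite -EU => A EA; exists m.
exists E; split=> //; split=> [m|m x [A EA Ax]|x].
- by apply: bigcup_open => A /EsubU/Uopen.
- by exists A => //; apply: (Eincr m).
- have : setT x by [].
  rewrite -Ucov => -[A]; rewrite -EU => -[m _ EA] Ax.
  by exists m; exists A.
Qed.

Lemma exhaustion_selection_U_fin :
  exhaustion_selection (@finite_set X) -> U_fin (covers X) (omega_covers X).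
Proof.
move=> sel U Ucov.
have [E EP] := choice (fun n => countable_open_exhaustion (proj1 (Ucov n))).
have [n|f fP] := sel (fun n m => \bigcup_(A in E n m) A).
  by have [_ _] := EP n.
exists (fun n => E n (f n)); split=> [n|].
  by have [Efin EU _] := EP n.
have EfT n : \bigcup_(A in E n (f n)) A <> setT.
  move=> ET; have [[_ Uopen _ UT] []] := Ucov n.
  have [Efin EU _] := EP n.
  exists (E n (f n)); split=> //; split=> //.
  - exact: finite_set_countable.
  - by move=> A /EU/Uopen.
  - by move=> /EU.
apply: omega_covers_intro.
- exact: countable_range.
- move=> _ [n _ <-]; apply: (@bigcup_open X) => A EA.
  have [[_ Uopen _ _] _] := Ucov n; have [_ EU _] := EP n.
  exact: Uopen (EU _ _ EA).
- by move=> [n _]; apply: EfT.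
- move=> G /fP[n Gn].
  by exists (\bigcup_(A in E n (f n)) A); first exists n.
Qed.

Lemma exhaustion_selection_S_fin :
  exhaustion_selection (@finite_set X) -> S_fin (covers X) (covers X).
Proof.
move=> sel U Ucov.
have [E EP] := choice (fun n => countable_open_exhaustion (Ucov n)).
have [n|f fP] := sel (fun n m => \bigcup_(A in E n m) A).
  by have [_ _] := EP n.
exists (fun n => E n (f n)).
have EU n : E n (f n) `<=` U n by have [_ + _] := EP n; apply.
have Efin n : finite_set (E n (f n)) by have [+ _ _] := EP n; apply.
split=> //; split.
- by apply: bigcup_countable => // n _; apply: finite_set_countable.
- by move=> A [n _ /EU]; have [_ Uopen _ _] := Ucov n; apply: Uopen.
- apply/seteqP; split=> // x _; have [n xn] := fP _ (finite_set1 x).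
  by have [A EA Ax] := xn x erefl; exists A => //; exists n.
- by move=> [n _ /EU]; have [_ _ _] := Ucov n.
Qed.

(** * Large covers and the families gimel(Omega) *)

(** If [x] were in finitely many members only, adjoin to [x] a point missed by
    each of them: this finite set is in no member at all. *)
Lemma omega_cover_large U : omega_covers X U -> large_covers X U.
Proof.
move=> [Ucov Uom]; split=> // x xfin; have [_ _ _ UT] := Ucov.
have /choice[y yP] : forall A, exists y, U A -> ~ A y.
  move=> A; have [UA|nUA] := pselect (U A); last by exists x.
  have /eqP/setTPn[y nAy] : A <> setT by move=> AT; rewrite AT in UA.
  by exists y.
have Gfin : finite_set (x |` y @` [set A | U A /\ A x]).
  by rewrite finite_setU; split; [exact: finite_set1|exact: finite_image].
have [A UA GA] := Uom _ Gfin.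
have Ax : A x by apply: GA; left.
by apply: (yP A) => //; apply: GA; right; exists A.
Qed.

(** The common content of the two alternatives in the definition of gimel. It
    is all that is needed to recover the selection principle. *)
Lemma gimel_omega_blocks U : gimel (omega_covers X) U ->
  exists P : set (set (set X)), [/\ \bigcup_(F in P) F = U, trivIset P id,
    forall F, P F -> finite_set F
    & forall G, finite_set G -> exists2 F, P F & G `<=` \bigcup_(A in F) A].
Proof.
move=> [_ [[P [PU Ptriv Pfin]]|[P [[PU Ptriv _] Pfin [_ Pom]]]]].
- exists (range P); split.
  + by rewrite bigcup_image.
  + by move=> _ _ [i _ <-] [j _ <-] /Ptriv ->.
  + by move=> _ [n _ <-]; case: (Pfin n).
  + move=> G _; exists (P 0%N); first by exists 0%N.
    by case: (Pfin 0%N) => _ [_ _ -> _].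
- exists P; split=> // G /Pom[_ [[F PF <-] _] GF]; by exists F.
Qed.

(** If [x] is in finitely many members, then only finitely many of the disjoint
    pieces have a union containing [x]. *)
Lemma gimel_omega_large U : gimel (omega_covers X) U -> large_covers X U.
Proof.
move=> [Ucov Ugim]; split=> // x xfin.
case: Ugim => [[P [PU Ptriv Pcov]]|[P [[PU Ptriv _] _ Pom]]].
- (* Each set containing [x] lies in a piece of index less than [M]; but the
     piece of index [M] covers [x] too. *)
  have [M PM] : exists M, forall A, U A /\ A x -> exists2 n, (n < M)%N & P n A.
    apply: (finite_uniform_bound xfin) => [A m m' mm' [n nm PnA]|A [+ _]].
      by exists n => //; apply: leq_trans mm'.
    by rewrite -PU => -[n _ PnA]; exists n.+1, n.
  have [_ [_ _ PMcov _]] := Pcov M.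
  have : setT x by [].
  rewrite -PMcov => -[A PMA Ax].
  have UA : U A by rewrite -PU; exists M.
  have [n nM PnA] := PM A (conj UA Ax).
  have nM' : n = M by apply: Ptriv => //; exists A.
  by rewrite nM' ltnn in nM.
- (* Sending [A] to the union of its piece maps the members containing [x]
     onto the members of the omega-cover of unions that contain [x]. *)
  have [_ /(_ x)] := omega_cover_large Pom; apply.
  pose blk A := \bigcup_(F in [set F | P F /\ F A]) \bigcup_(A' in F) A'.
  apply: sub_finite_set (finite_image blk xfin).
  move=> _ [[[F PF <-] _] [A FA Ax]]; exists A.
    by split=> //; rewrite -PU; exists F.
  apply/seteqP; split=> [y [F' [PF' F'A] F'y]|y Fy]; last by exists F.
  by rewrite (_ : F = F')//; apply: Ptriv => //; exists A.
Qed.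

(** Either all tails of an enumeration of [U] have finite subcovers, and then
    [U] is multifinite, or some tail has none, and then intervals far out have
    proper unions and form an omega-cover. *)
Lemma large_gimel_omega U : exhaustion_selection (@finite_set X) ->
  large_covers X U -> gimel (omega_covers X) U.
Proof.
move=> sel [Ucov Ularge]; split=> //; have [Ucount Uopen UX UT] := Ucov.
have [[x0 _]|/forallNP X0] := pselect (exists x : X, True); last first.
  (* Over the empty space the only cover is the empty family. *)
  have U0 A : ~ U A.
    move=> UA; apply: UT; rewrite -(_ : A = setT)//.
    by apply/seteqP; split=> // x; have := X0 x.
  left; exists (fun=> U); split=> [|i j _ _ [A [/U0]]//|n].
    by apply/seteqP; split=> [A []//|A UA]; exists 0%N.
  by split=> //; rewrite (_ : U = set0)//; apply/seteqP; split.
have Uinf : infinite_set U by apply: sub_infinite_set (Ularge x0) => A [].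
have /card_esym/card_set_bijP[u [u_fun u_inj u_surj]] :=
  eq_card_nat Ucount Uinf.
have uU : range u = U by apply/seteqP; split=> // _ [i _ <-]; apply: u_fun.
have {}u_inj : injective u by move=> i j; apply: u_inj; rewrite inE.
have Uu i : U (u i) by rewrite -uU; exists i.
pose W a b := \bigcup_(i in interval a b) u i.
have Wmono a a' b b' : (a <= a')%N -> (b' <= b)%N -> W a' b' `<=` W a b.
  move=> aa' bb' x [i /andP[a'i ib'] uix]; exists i => //; apply/andP.
  by split; [exact: leq_trans a'i|exact: leq_trans bb'].
have Wopen a b : open (W a b) by apply: bigcup_open => i _; apply: Uopen.
have Wex n : exhaustion (W n).
  split=> // [m|x]; first exact: Wmono.
  apply: contrapT => /forallNP xW; apply: (Ularge x).
  apply: sub_finite_set (finite_image u (finite_II n)) => A [].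
  rewrite -{1}uU => -[i _ <-] uix; exists i => //=; rewrite ltnNge.
  apply/negP => ni; apply: (xW i.+1); exists i => //.
  by rewrite /interval /= ni ltnSn.
have WE a b : \bigcup_(A in u @` interval a b) A = W a b.
  by rewrite bigcup_image.
have sub_cov a b : u @` interval a b `<=` U by move=> _ [i _ <-].
have fin a b : finite_set (u @` interval a b).
  by apply: finite_image; apply: interval_finite.
have [Wfull|] := pselect (forall n, exists m, W n m = setT).
  have [g gP] := choice Wfull.
  pose l := nat_rec (fun=> nat) 0%N (fun _ lj => maxn lj.+1 (g lj)).
  have l_incr j : (l j < l j.+1)%N by rewrite /= leq_maxl.
  have [lU ltriv] := intervals_partition u_inj (erefl : l 0%N = 0%N) l_incr.
  left; eexists; split; [exact: etrans lU uU|exact: ltriv|].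
  move=> j; split=> //; split.
  + exact: finite_set_countable.
  + by apply: subset_trans (sub_cov _ _) Uopen.
  + rewrite WE -subTset -(gP (l j)); apply: Wmono => //=.
    exact: leq_maxr.
  + by move=> /sub_cov.
move=> /existsNP[n0 /forallNP Wn0].
have [h hP] := exhaustion_selection_uniform sel (fun _ n => Wex n).
have [l [l0 l_incr lP]] := consecutive_intervals Wmono hP.
have [lU ltriv] := intervals_partition u_inj l0 l_incr.
right; exists (range (fun j => u @` interval (l j) (l j.+1))).
have l_ge j : (j <= l j)%N by elim: j => // j IHj; apply: leq_ltn_trans IHj _.
split.
- split.
  + by rewrite /cover bigcup_image lU uU.
  + by move=> _ _ [i _ <-] [j _ <-] /ltriv ->.
  + move=> _ [j _ <-]; exists (u (l j)), (l j) => //.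
    by rewrite /interval /= leqnn l_incr.
- by move=> _ [j _ <-].
- apply: omega_covers_intro.
  + apply: sub_countable (subset_card_le _) (countable_range
      (fun j => W (l j) (l j.+1))).
    by move=> _ [[_ [j _ <-] <-] _]; exists j; rewrite // WE.
  + by move=> _ [[_ [j _ <-] <-] _]; rewrite WE.
  + by move=> [_ /=].
  + move=> G /lP/(_ n0)[j n0j Gj]; exists (W (l j) (l j.+1)) => //; split.
      by rewrite -WE; exists (u @` interval (l j) (l j.+1)) => //; exists j.
    (* The interval starts at [l j >= j >= n0], beyond which no finite union
       is the whole space. *)
    move=> /= WT; apply: (Wn0 (l j.+1)); rewrite -subTset -WT.
    apply: Wmono => //.
    exact: leq_trans (l_ge j).
Qed.

(** * The Menger game *)

(** [V n m] is the set of points secured by the answer [m] in all positions of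
    length at most [n]. It is an infinite intersection, but a position with an
    entry [a >= m] contributes nothing new: [W (rcons s m)] is included in
    [W (rcons s a)], hence in the set of each extension. What remains is a
    finite intersection over entries less than [m], so [V n m] is open, and the
    same remark shows that the [V n m] cover the space. *)
Lemma tree_exhaustion (W : seq nat -> set X) :
  (forall s, open (W s)) -> (forall s m, W s `<=` W (rcons s m)) ->
  (forall s, exhaustion (fun m => W (rcons s m))) ->
  exists V : nat -> nat -> set X, (forall n, exhaustion (V n)) /\
    forall s m, V (size s) m `<=` W (rcons s m).
Proof.
move=> Wopen Wext Wex.
have Wle s m m' : (m <= m')%N -> W (rcons s m) `<=` W (rcons s m').
  exact: exhaustion_le (Wex s).
have Wcat s t : W s `<=` W (s ++ t).
  elim: t s => [|a t IHt] s; first by rewrite cats0.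
  by rewrite -cat_rcons; apply: subset_trans (IHt _).
pose V n s m :=
  [set x | forall t, (size t <= n)%N -> W (rcons (s ++ t) m) x].
have V0 s m : V 0%N s m = W (rcons s m).
  apply/seteqP; split=> [x /(_ [::])|x Wx t]; first by rewrite cats0; apply.
  by rewrite leqn0 size_eq0 => /eqP ->; rewrite cats0.
(* The recursion that exhibits [V n s m] as a finite intersection; [s] is the
   position reached so far. *)
have VS n s m : V n.+1 s m = W (rcons s m) `&`
    [set x | forall a, (a < m)%N -> V n (rcons s a) m x].
  apply/seteqP; split=> x.
    move=> Vx; split=> [|a am t tn]; last first.
      by rewrite cat_rcons; apply: Vx.
    by have := Vx [::]; rewrite cats0; apply.
  move=> [Wx Vx] [|a t] tn; first by rewrite cats0.
  have [am|ma] := ltnP a m; first by rewrite -cat_rcons; apply: Vx.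
  by rewrite rcons_cat /= -cat_rcons; apply: Wcat; apply: Wle ma _ Wx.
have Vex n s : exhaustion (V n s).
  elim: n s => [|n IHn] s.
    have [W1 W2 W3] := Wex s; split=> [m|m|x]; rewrite ?V0//.
    by have [m] := W3 x; exists m; rewrite V0.
  split=> [m|m x Vx t tn|x].
  - rewrite VS; apply: openI => //.
    rewrite (_ : mkset _ = ~` \bigcup_(a in `I_m) ~` V n (rcons s a) m).
      rewrite openC; apply: closed_bigcup => [|a _]; first exact: finite_II.
      by rewrite closedC; case: (IHn (rcons s a)).
    by rewrite setC_bigcup; apply: eq_bigcapr => a _; rewrite setCK.
  - by apply: Wle (Vx t tn).
  - have [_ _ /(_ x)[m0 Wx]] := Wex s.
    have [M VM] : exists M, forall a, `I_m0 a -> V n (rcons s a) M x.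
      apply: (finite_uniform_bound (finite_II m0)) => [a m m' mm'|a _].
        exact: exhaustion_le (IHn _) mm' _.
      by have [_ _] := IHn (rcons s a); apply.
    (* Entries below [m0] are handled by [M], those from [m0] on by [W]. *)
    exists (maxn m0 M); rewrite VS; split=> [|a _].
      by apply: Wle Wx; exact: leq_maxl.
    have [am0|m0a] := ltnP a m0.
      exact: exhaustion_le (IHn _) (leq_maxr _ _) _ (VM a am0).
    by move=> t _; rewrite rcons_cat; apply: Wcat; apply: Wle m0a _ Wx.
exists (fun n => V n [::]); split=> // s m x; exact.
Qed.

(** TWO answers with initial parts of ONE's covers, so plays are coded by
    sequences of heights, and the sets that can occur in the game are countably
    many, hence exhausted by finite families [D c]. Let [W c t] be the union of
    the sets outside [D c] that TWO has chosen up to position [t]. Large covers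
    stay covers when [D c] is removed, so [W c] satisfies the hypotheses of
    [tree_exhaustion]. One play that works for all [c] at once puts each point
    in chosen sets outside each [D c], hence in infinitely many. *)
Lemma Menger_ONE_no_winning_strategy : S_fin (covers X) (covers X) ->
  ~ G_fin_ONE_has_winning_strategy (large_covers X) (large_covers X).
Proof.
move=> menger [sigma [sigma_large sigma_win]].
have sigma_cov s : is_cover (sigma s) by case: (sigma_large s).
have sigma_count s : countable (sigma s) by case: (sigma_cov s).
have [E EP] := choice (fun s => countable_filtration (sigma_count s)).
pose answers := foldl (fun s m => rcons s (E s m)) [::].
have answers_rcons t m :
    answers (rcons t m) = rcons (answers t) (E (answers t) m).
  by rewrite /answers foldl_rcons.
have [|D [Dfin Dmono DU]] :=
    @countable_filtration _ (\bigcup_t sigma (answers t)).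
  by apply: bigcup_countable => //; apply: countableP.
have EU s m : E s m `<=` sigma s.
  by have [_ _ <-] := EP s => A EA; exists m.
pose W c t := \bigcup_(A in
  [set A | (exists2 F, F \in answers t & F A) /\ ~ D c A]) A.
have Wrcons c t m : W c (rcons t m) =
    W c t `|` \bigcup_(A in E (answers t) m `\` D c) A.
  rewrite /W answers_rcons; apply/seteqP; split=> x.
    move=> [A [[F + FA] DA] Ax]; rewrite mem_rcons inE => /orP[/eqP FE|Ft].
      by right; exists A => //; split=> //; rewrite -FE.
    by left; exists A => //; split=> //; exists F.
  move=> [[A [[F Ft FA] DA] Ax]|[A [EA DA] Ax]]; exists A => //; split=> //.
    by exists F => //; rewrite mem_rcons inE Ft orbT.
  by exists (E (answers t) m) => //; rewrite mem_rcons inE eqxx.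
have Eopen s m : E s m `<=` open.
  by apply: subset_trans (@EU s m) _; case: (sigma_cov s).
have Wopen c t : open (W c t).
  elim/last_ind: t => [|t m IHt]; last first.
    by rewrite Wrcons; apply: openU => //; apply: bigcup_open => A [/Eopen].
  by apply: bigcup_open => A [[F]]; rewrite in_nil.
have Wext c t m : W c t `<=` W c (rcons t m).
  by rewrite Wrcons; apply: subsetUl.
have Wex c t : exhaustion (fun m => W c (rcons t m)).
  split=> // [m|x].
    rewrite !Wrcons; apply: setUS => x [A [EA DA] Ax].
    exists A => //; split=> //.
    by have [_ Emono _] := EP (answers t); apply: Emono EA.
  have [_ _ EE] := EP (answers t).
  have [_ /(_ x) xinf] := sigma_large (answers t).
  have [A [[UA Ax] DA]] := infinite_setN0 (infinite_setD xinf (Dfin c)).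
  move: UA; rewrite -EE => -[m _ EA]; exists m; rewrite Wrcons; right.
  by exists A.
have [V VP] := choice (fun c => tree_exhaustion (Wopen c) (Wext c) (Wex c)).
have [f fP] := exhaustion_selection_uniform (S_fin_exhaustion_selection menger)
  (fun c => proj1 (VP c)).
pose F n := E (answers (mkseq f n)) (f n).
have answersE n : answers (mkseq f n) = mkseq F n.
  by elim: n => // n IHn; rewrite !mkseqS answers_rcons {1}IHn.
have Fsigma n : F n `<=` sigma (answers (mkseq f n)) by apply: EU.
have Fwin x c : exists2 A, (\bigcup_n F n) A /\ A x & ~ D c A.
  have [|n _ Vx] := fP [set x] _ c; first by exists x.
  have /(_ x erefl) := Vx; rewrite -{1}(size_mkseq f n) => /(proj2 (VP c)).
  rewrite -mkseqS => -[A [[F0 F0n F0A] DA] Ax]; exists A => //; split=> //.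
  by move: F0n; rewrite answersE => /mapP[i _ FE]; exists i => //; rewrite -FE.
have Fplay : G_fin_play_against sigma F.
  move=> n; rewrite -answersE; split=> //.
  by have [+ _ _] := EP (answers (mkseq f n)); apply.
apply: (sigma_win F Fplay).
have FD : \bigcup_n F n `<=` \bigcup_t sigma (answers t).
  by move=> A [n _ /Fsigma]; exists (mkseq f n).
split; last first.
  move=> x xfin.
  have [c cP] : exists c, forall A, (\bigcup_n F n) A /\ A x -> D c A.
    apply: (finite_uniform_bound (R := fun A c => D c A) xfin).
      by move=> A m m' mm'; apply: Dmono.
    by move=> A [/FD]; rewrite -DU => -[c _ DA] _; exists c.
  by have [A /cP] := Fwin x c.
split.
- by apply: sub_countable (subset_card_le FD) _; rewrite -DU;
    apply: bigcup_countable => // c _; exact: finite_set_countable.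
- by move=> A [n _]; apply: Eopen.
- apply/seteqP; split=> // x _; have [A [FA Ax] _] := Fwin x 0%N.
  by exists A.
- by move=> [n _ /Fsigma]; case: (sigma_cov (answers (mkseq f n))).
Qed.

Lemma Menger_no_winning_omega_strategy BB : S_fin (covers X) (covers X) ->
  large_covers X = BB ->
  ~ G_fin_ONE_has_winning_strategy (omega_covers X) BB.
Proof.
move=> menger <- [sigma [sigma_om sigma_win]].
apply: (Menger_ONE_no_winning_strategy menger); exists sigma; split=> // s.
exact: omega_cover_large.
Qed.

Lemma game_S_fin AA BB : ~ @G_fin_ONE_has_winning_strategy X AA BB ->
  S_fin AA BB.
Proof.
move=> no_win U UA; apply: contrapT => /forallNP no_sel; apply: no_win.
exists (fun s => U (size s)); split=> [s //|F Fplay FB].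
apply: (no_sel F); split=> // n.
by have := Fplay n; rewrite size_mkseq.
Qed.

(** * The partition relation *)

Lemma filter_finite_forall (T S : Type) (p : set_system T) (D : set S)
    (Q : S -> set T) : Filter p -> finite_set D ->
  (forall a, D a -> p (Q a)) -> p [set b | forall a, D a -> Q a b].
Proof.
move=> pF /(@finite_seqP {classic S})[s ->].
elim: s => [|a s IHs] Qp; first by apply: filterS filterT.
have Qa : p (Q a) by apply: Qp; rewrite /= inE eqxx.
have Qs : p [set b | forall a, [set` s] a -> Q a b].
  by apply: IHs => a' /= sa'; apply: Qp; rewrite /= inE sa' orbT.
apply: filterS (filterI Qa Qs) => b [Qab Qsb] a' /=; rewrite inE.
by move=> /orP[/eqP ->//|]; apply: Qsb.
Qed.

Lemma ultrafilter_finite_coloring (T : Type) (p : set_system T)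
    (c : T -> nat) k : UltraFilter p -> p [set t | (1 <= c t <= k)%N] ->
  exists2 j, (1 <= j <= k)%N & p [set t | c t = j].
Proof.
move=> pU; have pP := ultra_proper (UltraFilter := pU); elim: k => [|k IHk] pk.
  have [t /= /andP[ct1 ct0]] := filter_ex pk.
  by have := leq_trans ct1 ct0.
have [pk1|pk1] := in_ultra_setVsetC [set t | c t = k.+1] pU.
  by exists k.+1 => //=.
have [|j /andP[j1 jk] pj] := IHk; last by exists j => //; rewrite j1 leqW.
apply: filterS (filterI pk pk1) => t [/= /andP[-> tk] /eqP ctk] /=.
by rewrite -ltnS ltn_neqAle ctk.
Qed.

(** The sets of members of [U] that include a given finite set form a filter
    base, since [U] is an omega-cover. A set that meets all of them is an
    omega-cover in its turn, whereas a single member of [U], being a proper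
    subset of the space, misses one of them. *)
Lemma omega_cover_ultrafilter U : omega_covers X U ->
  exists p : set_system (set X), [/\ UltraFilter p, p U,
    forall S, p S -> S `<=` U -> omega_covers X S
    & forall A, U A -> p (~` [set A])].
Proof.
move=> [[Ucount Uopen UX UT] Uom].
pose base G := U `&` [set A | G `<=` A].
have fltr : ProperFilter (filter_from (@finite_set X) base).
  apply: filter_from_proper => [|G /Uom[A UA GA]]; last by exists A.
  apply: filter_from_filter; first by exists set0.
  move=> G1 G2 G1fin G2fin; exists (G1 `|` G2); first by rewrite finite_setU.
  by move=> A [UA GA]; split; split=> // x Gx; apply: GA; [left|right].
have [p [pU pbase]] := ultraFilterLemma fltr; exists p.
have pP := ultra_proper (UltraFilter := pU).
have pG G : finite_set G -> p (base G) by move=> Gfin; apply: pbase; exists G.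
split=> //.
- by apply: filterS (pG set0 _) => // A [].
- move=> S pS SU; apply: omega_covers_intro.
  + by apply: sub_countable Ucount; apply: subset_card_le.
  + by apply: subset_trans Uopen.
  + by move=> /SU.
  + move=> G Gfin; have [A [SA [_ GA]]] := filter_ex (filterI pS (pG G Gfin)).
    by exists A.
- move=> A UA.
  have /eqP/setTPn[y nAy] : A <> setT by move=> AT; rewrite AT in UA.
  apply: filterS (pG _ (finite_set1 y)) => B [_ yB] BA.
  by apply: nAy; rewrite -BA; apply: yB.
Qed.

(** With [p] from [omega_cover_ultrafilter], each [A] in [U] has a colour
    [i A] such that [f [set A; B] = i A] for [p]-almost all [B], and some [j]
    is the colour of [p]-almost all [A]; these form [V]. ONE plays the members
    of [V] not yet chosen whose colour with everything TWO has chosen is [j]: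
    they form a set in [p], as TWO has chosen finitely many sets, so this is an
    omega-cover. The moves of TWO are then disjoint, and in a play won by TWO
    they are the required pieces. *)
Lemma game_baumgartner_taylor k :
  ~ G_fin_ONE_has_winning_strategy (omega_covers X) (gimel (omega_covers X)) ->
  baumgartner_taylor (omega_covers X) (gimel (omega_covers X)) k.
Proof.
move=> no_win U Uom f f_col.
have [p [pU pUU pom pne]] := omega_cover_ultrafilter Uom.
have pP := ultra_proper (UltraFilter := pU).
have /choice[i iP] : forall A, exists i, U A ->
    (1 <= i <= k)%N /\ p [set B | f [set A; B] = i].
  move=> A; have [UA|nUA] := pselect (U A); last by exists 0%N.
  suff [i ik pi] : exists2 i, (1 <= i <= k)%N & p [set B | f [set A; B] = i].
    by exists i.
  apply: ultrafilter_finite_coloring.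
  apply: filterS (filterI pUU (pne A UA)) => B [UB BA] /=; apply: f_col; split.
    by move=> _ [->|->].
  by apply: card_pair => AB; apply: BA.
have [|j jk pj] := @ultrafilter_finite_coloring _ p i k pU.
  by apply: filterS pUU => A /iP[].
pose V := U `&` [set A | i A = j].
have pV : p V by apply: filterI.
pose legal (s : seq (set (set X))) :=
  forall F, F \in s -> finite_set F /\ F `<=` V.
(* Positions in which TWO did not follow the rules put no constraint on ONE. *)
pose sigma s := V `&` [set B | legal s ->
  forall F, F \in s -> forall A, F A -> B <> A /\ f [set A; B] = j].
have psigma s : p (sigma s).
  apply: filterI => //.
  have [s_legal|s_illegal] := pselect (legal s); last first.
    by apply: filterS filterT => B _ /s_illegal.
  have fin_s : finite_set [set` s] by exact: finite_seq.
  suff : p [set B | forall F, [set` s] F ->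
      forall A, F A -> B <> A /\ f [set A; B] = j].
    by apply: filterS => B Bs _; apply: Bs.
  apply: (filter_finite_forall _ fin_s (Q := fun F =>
    [set B | forall A, F A -> B <> A /\ f [set A; B] = j])).
  move=> F /s_legal[Ffin FV].
  apply: (filter_finite_forall _ Ffin
    (Q := fun A => [set B | B <> A /\ f [set A; B] = j])).
  by move=> A /FV[UA <-]; apply: filterI (pne A UA) (proj2 (iP A UA)).
have [F [Fplay Fgim]] : exists F : nat -> set (set X),
    G_fin_play_against sigma F /\ gimel (omega_covers X) (\bigcup_n F n).
  apply: contrapT => /forallNP no_play; apply: no_win; exists sigma; split.
    by move=> s; apply: pom => // A [[]].
  by move=> F Fplay Fgim; apply: (no_play F).
have FV n : F n `<=` V by move=> A /(proj2 (Fplay n))[].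
have Flegal n : legal (mkseq F n).
  by move=> _ /mapP[m _ ->]; split=> //; case: (Fplay m).
have Fhom m n A B : (m < n)%N -> F m A -> F n B ->
    B <> A /\ f [set A; B] = j.
  move=> mn FA /(proj2 (Fplay n))[_ /(_ (Flegal n) (F m))]; apply=> //.
  by apply/mapP; exists m => //; rewrite mem_iota.
exists (\bigcup_n F n), F, j; split=> //.
- by split=> // A [n _ /FV[]].
- split=> // m n _ _ [A [FmA FnA]].
  have [mn|nm|//] := ltngtP m n; first by have [] := Fhom m n A A mn FmA FnA.
  by have [] := Fhom n m A A nm FnA FmA.
- by move=> n; case: (Fplay n).
- move=> A B [m _ FA] [n _ FB] AB.
  have [mn|nm|mn] := ltngtP m n.
  + by have [] := Fhom m n A B mn FA FB.
  + by rewrite setUC; have [] := Fhom n m B A nm FB FA.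
  + by case: AB; exists m; split=> //; rewrite mn.
Qed.

(** * Recovering the selection principle *)

(** Give each piece the least row of its members. Rows decrease, so the piece
    lies in that row, below the largest column of its members. Each row meets
    finitely many pieces, as they are disjoint, so one height suits all pieces
    of the row. *)
Lemma blocks_exhaustion_selection (V : nat -> nat -> set X) U
    (row col : set X -> nat) :
  (forall n, exhaustion (V n)) -> (forall n m, V n.+1 m `<=` V n m) ->
  gimel (omega_covers X) U ->
  (forall A, U A -> A `<=` V (row A) (col A)) ->
  (forall n, finite_set [set A | U A /\ row A = n]) ->
  exists f : nat -> nat, forall G, finite_set G -> exists n, G `<=` V n (f n).
Proof.
move=> Vex Vdecr /gimel_omega_blocks[P [PU Ptriv Pfin Pom]] Usub Ufin.
have Vle n n' m : (n <= n')%N -> V n' m `<=` V n m.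
  move=> /subnK <-; elim: (n' - n)%N => // d IHd.
  by rewrite addSn; apply: subset_trans (Vdecr _ _) _.
have /choice[f fP] : forall n, exists M, forall A, U A /\ row A = n ->
    forall F, P F -> F A -> forall A', F A' -> (col A' <= M)%N.
  move=> n; apply: (finite_uniform_bound (Ufin n)).
    move=> A m m' mm' Rm F PF FA A' FA'.
    exact: leq_trans (Rm F PF FA A' FA') mm'.
  move=> A []; rewrite -PU => -[F PF FA] _.
  have [M MP] : exists M, forall A', F A' -> (col A' <= M)%N.
    apply: (finite_uniform_bound (Pfin F PF)) => [A' m m' mm' Am|A' _].
      exact: leq_trans mm'.
    by exists (col A').
  exists M => F' PF' F'A; rewrite (_ : F' = F)//.
  by apply: Ptriv => //; exists A.
exists f => G Gfin; have [F PF GF] := Pom G Gfin.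
have [[x Gx]|/forallNP G0] := pselect (exists x, G x); last first.
  by exists 0%N => x /G0.
pose rowF := [pred n | `[< exists2 A, F A & row A = n >]].
have rowF_ex : exists n, rowF n.
  by have [A FA _] := GF x Gx; exists (row A); apply/asboolP; exists A.
have [n /asboolP[A0 FA0 rowA0] n_min] := ex_minnP rowF_ex.
have FU A : F A -> U A by move=> FA; rewrite -PU; exists F.
exists n => y /GF[A FA Ay].
have nA : (n <= row A)%N by apply: n_min; apply/asboolP; exists A.
apply: Vle nA _ _; apply: exhaustion_le (Vex _) _ _ (Usub A (FU A FA) y Ay).
by apply: (fP n A0 _ F PF FA0 A FA); split=> //; apply: FU.
Qed.

Lemma S_fin_gimel_selection :
  S_fin (omega_covers X) (gimel (omega_covers X)) ->
  exhaustion_selection (@finite_set X).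
Proof.
move=> sfin; apply: exhaustion_selection_reduction => V Vex Vneq Vdecr.
have [n|F [Ffin Fgim]] := sfin (fun n => range (V n)).
  exact: exhaustion_omega_cover.
have /choice[pos posP] : forall A, exists q : nat * nat,
    (\bigcup_n F n) A -> F q.1 A /\ A = V q.1 q.2.
  move=> A; have [[n _ FA]|nFA] := pselect ((\bigcup_n F n) A); last first.
    by exists (0%N, 0%N).
  by have [m _ VA] := (proj2 (Ffin n)) A FA; exists (n, m).
apply: (blocks_exhaustion_selection (row := fun A => (pos A).1)
  (col := fun A => (pos A).2) Vex Vdecr Fgim) => [A /posP[_ {1}->]//|n].
by apply: sub_finite_set (proj1 (Ffin n)) => A [/posP[FA _] <-].
Qed.

(** Colour pairs of members of the omega-cover of all [V 0 n `&` V n m] by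
    whether they come from the same row [n]. A homogeneous set of the first
    kind would lie in a single row, below [V 0 n], and would not cover the
    space. For the second kind, each row lies in one of the finite pieces. *)
Lemma baumgartner_taylor_selection :
  baumgartner_taylor (omega_covers X) (gimel (omega_covers X)) 2 ->
  exhaustion_selection (@finite_set X).
Proof.
move=> BT; apply: exhaustion_selection_reduction => V Vex Vneq Vdecr.
pose W := [set V 0%N q.1 `&` V q.1 q.2 | q in [set: nat * nat]].
have Wom : omega_covers X W.
  apply: omega_covers_intro.
  - exact: sub_countable (card_image_le _ _) (countableP _).
  - move=> _ [[n m] _ <-]; apply: openI; first by case: (Vex 0%N).
    by case: (Vex n).
  - move=> [[n m] _ WT]; apply: (Vneq 0%N n); rewrite -subTset -WT.
    exact: subIsetl.
  - move=> G Gfin; have [n Gn] := exhaustion_finite (Vex 0%N) Gfin.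
    have [m Gm] := exhaustion_finite (Vex n) Gfin.
    exists (V 0%N n `&` V n m); first by exists (n, m).
    by rewrite subsetI.
have /choice[pos posP] : forall A, exists q : nat * nat,
    W A -> A = V 0%N q.1 `&` V q.1 q.2.
  move=> A; have [[q _ qA]|nWA] := pselect (W A); first by exists q.
  by exists (0%N, 0%N).
pose row A := (pos A).1.
pose same_row (D : set (set X)) := forall A B, D A -> D B -> row A = row B.
pose f D := if `[< same_row D >] then 1%N else 2%N.
have f1 A B : f [set A; B] = 1%N -> row A = row B.
  by rewrite /f; case: asboolP => // srow _; apply: srow; [left|right].
have f2 A B : f [set A; B] = 2%N -> row A <> row B.
  rewrite /f; case: asboolP => // srow _ rAB; apply: srow.
  by move=> _ _ [->|->] [->|->].
have [|B [C [j [[BW Bgim] [CB Ctriv] Cfin j12 Bhom]]]] := BT W Wom f.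
  by move=> D _; rewrite /f; case: ifP.
apply: (blocks_exhaustion_selection (row := row) (col := fun A => (pos A).2)
  Vex Vdecr Bgim) => [A /BW/posP {1}-> x []//|n].
have [[A [BA rowA]]|/forallNP none] := pselect (exists A, B A /\ row A = n);
  last first.
  by rewrite (_ : mkset _ = set0)//; apply/seteqP; split=> // A /none.
have : B A by [].
rewrite -{1}CB => -[a _ CaA].
have [j1|j2] : j = 1%N \/ j = 2%N.
  by move: j12; case: j {Bhom} => [|[|[|j]]] // _; [left|right].
- have [Bcov Blarge] := gimel_omega_large Bgim.
  have /eqP/setTPn[x0 _] := Vneq 0%N 0%N.
  have Brow A' : B A' -> A' `<=` V 0%N n.
    move=> BA'; have := BA'; rewrite -{1}CB => -[a' _ Ca'A'].
    (* [B] is infinite, so a third set [D] outside the pieces of [A] and [A']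
       compares them. *)
    have fin : finite_set (C a `|` C a') by rewrite finite_setU.
    have [D [[BD _] nCD]] := infinite_setN0 (infinite_setD (Blarge x0) fin).
    have row_eq b E : B E -> C b E -> ~ C b D -> row E = row D.
      move=> BE CbE nCbD; apply: f1; rewrite -j1; apply: Bhom => //.
      move=> [b' [Cb'E Cb'D]]; apply: nCbD; rewrite (_ : b = b')//.
      by apply: Ctriv => //; exists E.
    rewrite -rowA (row_eq a A)//; last by move=> CaD; apply: nCD; left.
    rewrite -(row_eq a' A')//; last by move=> CaD; apply: nCD; right.
    by rewrite {1}(posP A' (BW _ BA')); apply: subIsetl.
  have [_ _ BX _] := Bcov.
  case: (Vneq 0%N n); rewrite -subTset -BX => x [A' BA' A'x].
  exact: Brow A'x.
- apply: sub_finite_set (Cfin a) => A' [BA' rowA'].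
  apply: contrapT => nCA'; apply: (@f2 A A'); last by rewrite rowA rowA'.
  rewrite -j2; apply: Bhom => // -[b [CbA CbA']]; apply: nCA'.
  by rewrite (_ : a = b)//; apply: Ctriv => //; exists A.
Qed.

End Covers.

Theorem theorem21 (X : topologicalType) :
  [<-> (* 1 *) U_fin (covers X) (omega_covers X);
       (* 2 *) S_fin (covers X) (covers X) /\
               large_covers X = gimel (omega_covers X);
       (* 3 *) ~ G_fin_ONE_has_winning_strategy
                   (omega_covers X) (gimel (omega_covers X));
       (* 4 *) S_fin (omega_covers X) (gimel (omega_covers X));
       (* 5 *) forall k : nat, (0 < k)%N ->
                 baumgartner_taylor
                   (omega_covers X) (gimel (omega_covers X)) k;
       (* 6 *) baumgartner_taylor
                 (omega_covers X) (gimel (omega_covers X)) 2].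
Proof.
have selE : exhaustion_selection (@finite_set X) ->
    S_fin (covers X) (covers X) /\ large_covers X = gimel (omega_covers X).
  move=> sel; split; first exact: exhaustion_selection_S_fin.
  apply/seteqP; split=> U; first exact: large_gimel_omega.
  exact: gimel_omega_large.
tfae.
- by move=> /U_fin_exhaustion_selection/selE.
- by move=> [menger]; apply: Menger_no_winning_omega_strategy.
- exact: game_S_fin.
- move=> /S_fin_gimel_selection/selE[menger gimelE] k _.
  exact/game_baumgartner_taylor/Menger_no_winning_omega_strategy.
- exact.
- by move=> /baumgartner_taylor_selection/exhaustion_selection_U_fin.
Qed.
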